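(* Let $n,m\geq 1$ and let $(S_1,\dots,S_{n+m})$ be a random vector of real scores which is exchangeable (its distribution is invariant under any permutation of coordinates) and has almost surely no ties. Define the conformal $p$-values $$p_i=\frac{1}{n+1}\Big(1+\sum_{j=1}^n \mathbf{1}\{S_j\geq S_{n+i}\}\Big),\quad i\in\{1,\dots,m\}.$$ Then $(p_1,\dots,p_m)$ has joint distribution $P_{n,m}$; in particular this joint distribution does not depend on the specific distribution of the scores.
   Context: For a fixed $U=(U_1,\dots,U_n)\in[0,1]^n$ with order statistics $U_{(1)}\leq\dots\leq U_{(n)}$ and conventions $U_{(0)}=0$, $U_{(n+1)}=1$, $P^U$ is the distribution on $\{\ell/(n+1):\ell\in\{1,\dots,n+1\}\}$ with $P^U(\{\ell/(n+1)\})=U_{(\ell)}-U_{(\ell-1)}$. $P_{n,m}$ is the distribution on $[0,1]^m$ of $(q_1,\dots,q_m)$ generated as follows: $U_1,\dots,U_n$ i.i.d. $\mathrm{Unif}[0,1]$, and conditionally on $U=(U_1,\dots,U_n)$, $q_1,\dots,q_m$ i.i.d. with distribution $P^U$. *)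

(* Defs.v *)
From HB Require Import structures.
From mathcomp Require Import all_boot all_order all_algebra all_fingroup.
From mathcomp Require Import all_classical all_reals all_analysis.
Set Implicit Arguments. Unset Strict Implicit. Unset Printing Implicit Defensive.
Import Order.TTheory GRing.Theory Num.Theory.
Local Open Scope classical_set_scope.
Local Open Scope ring_scope.

Definition rectangles (R : realType) (k : nat) : set (set ('I_k -> R)) :=
  [set A | exists B : 'I_k -> set R, (forall j, measurable (B j)) /\
           A = [set x | forall j, B j (x j)]].

Definition borel_prod (R : realType) (k : nat) : set (set ('I_k -> R)) :=
  smallest (sigma_algebra setT) (@rectangles R k).

Definition exchangeable (d : measure_display) (T : measurableType d)
  (R : realType) (P : probability T R) (k : nat) (S : 'I_k -> T -> R) : Prop :=
  forall (s : 'S_k) (A : set ('I_k -> R)), borel_prod A ->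
    P [set t | A (fun j => S (s j) t)] = P [set t | A (fun j => S j t)].

Definition no_ties_as (d : measure_display) (T : measurableType d)
  (R : realType) (P : probability T R) (k : nat) (S : 'I_k -> T -> R) : Prop :=
  {ae P, forall t, injective (fun j => S j t)}.

(* Conformal p-value p_{i+1} (i : 'I_m, 0-based): score S_{n+i+1} is
   S (rshift n i), calibration scores S_{j+1} are S (lshift m j). *)
Definition conformal_pvalue (R : realType) (n m : nat)
  (S : 'I_(n + m) -> R) (i : 'I_m) : R :=
  (1 + #|[set j : 'I_n | S (rshift n i) <= S (lshift m j)]|)%:R / (n.+1)%:R.

(* Order statistics with conventions U_(0) = 0, U_(n+1) = 1:
   ostat u k = U_(k) for u = (U_1,...,U_n) listed as a sequence. *)
Definition ostat (R : realType) (u : seq R) (k : nat) : R :=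
  nth 0 (0 :: rcons (sort <=%R u) 1) k.

(* E[F(U_1,...,U_n)] for U_1,...,U_n i.i.d. Unif[0,1], F >= 0, written as
   the iterated Lebesgue integral over [0,1]^n (Tonelli). *)
Fixpoint iid_unif_expect (R : realType) (n : nat) (F : seq R -> R) : \bar R :=
  match n with
  | 0 => (F [::])%:E
  | n'.+1 => (\int[@lebesgue_measure R]_(x in `[0%R, 1%R])
                 iid_unif_expect n' (fun s => F (x :: s)))%E
  end.

(* P_{n,m}({(q_1,...,q_m)}) for q_i = (l i).+1 / (n+1), l i : 'I_(n+1):
   E_U [ prod_i P^U({q_i}) ] = E_U [ prod_i (U_(l_i+1) - U_(l_i)) ]. *)
Definition Pnm_pmf (R : realType) (n m : nat) (l : 'I_m -> 'I_n.+1) : \bar R :=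
  @iid_unif_expect R n (fun u => \prod_(i < m) (ostat u (l i).+1 - ostat u (l i))).

(* Main.v *)
(** The p-values depend only on the relative order of the scores.  For an
  exchangeable vector without ties, averaging over the permutations of the
  coordinates shows that an event determined by the relative order has
  probability #{good permutations} / N!, whatever the law of the scores.
  On the other side, a spacing U_(l+1) - U_(l) is the Lebesgue measure of the
  set of v in [0, 1] with exactly l of the U_j below v, so that P_{n,m} is the
  law of such a relative-order event for n + m independent uniform variables,
  which are exchangeable without ties.  The two events differ by a reversal of
  the order, which does not change the number of good permutations. *)
Require Import Defs.
From HB Require Import structures.
From mathcomp Require Import all_boot all_order all_algebra all_fingroup.
From mathcomp Require Import all_classical all_reals all_analysis.
From mathcomp Require Import measurable_realfun.
Import Order.TTheory GRing.Theory Num.Theory.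
Local Open Scope classical_set_scope.
Local Open Scope ring_scope.
Set Implicit Arguments. Unset Strict Implicit. Unset Printing Implicit Defensive.

(** * Order patterns *)

Local Notation pattern N := {ffun 'I_N * 'I_N -> bool}.

Definition order_pattern {disp} {T : porderType disp} {N : nat}
    (x : 'I_N -> T) : pattern N :=
  [ffun p => (x p.1 <= x p.2)%O].

Definition converse {N : nat} (M : pattern N) : pattern N :=
  [ffun p => M (p.2, p.1)].

Definition pattern_frequency (R : numFieldType) {N : nat}
    (H : pred (pattern N)) : R :=
  #|[pred s : 'S_N | H (order_pattern s)]|%:R / N`!%:R.

Lemma injective_order_pattern {disp} {T : orderType disp} (N : nat)
    (x : 'I_N -> T) :
  injective x -> exists r : 'S_N, order_pattern x = order_pattern r.
Proof.
move=> x_inj.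
pose rank i := #|[pred j | (x j < x i)%O]|.
have rank_ltN i : (rank i < N)%N.
  rewrite -[ltnRHS]card_ord; apply: proper_card.
  apply/properP; split; first exact: fintype.subset_predT.
  by exists i; rewrite ?inE ?ltxx.
have lt_rank i j : (x i < x j)%O -> (rank i < rank j)%N.
  move=> xij; apply: proper_card; apply/properP; split.
    by apply/fintype.subsetP => k; rewrite !inE => /lt_trans; apply.
  by exists i; rewrite ?inE ?ltxx.
have le_rank i j : (x i <= x j)%O = (rank i <= rank j)%N.
  case: (ltgtP (x i) (x j)) => [/lt_rank/ltnW ->//|/lt_rank|/x_inj ->].
    by rewrite ltnNge => /negbTE.
  by rewrite leqnn.
have rank_inj : injective (fun i => Ordinal (rank_ltN i)).
  by move=> i j [] rank_eq; apply/x_inj/le_anti; rewrite !le_rank rank_eq leqnn.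
exists (perm rank_inj); apply/ffunP => p.
by rewrite !ffunE !permE leEord /= le_rank.
Qed.

Lemma card_order_pattern_perm {disp} {T : orderType disp} (N : nat)
    (x : 'I_N -> T) (H : pred (pattern N)) :
  injective x ->
  #|[pred s : 'S_N | H (order_pattern (x \o s))]| =
  #|[pred s : 'S_N | H (order_pattern s)]|.
Proof.
move=> /injective_order_pattern[r /ffunP xr].
rewrite -!sum1_card [RHS](reindex_inj (@mulIg _ r)) /=.
apply: eq_bigl => s; rewrite !inE; congr H; apply/ffunP => p.
by rewrite !ffunE !permM; have := xr (s p.1, s p.2); rewrite !ffunE.
Qed.

Lemma pattern_frequency_converse (R : numFieldType) (N : nat)
    (H : pred (pattern N)) :
  pattern_frequency R (H \o converse) = pattern_frequency R H.
Proof.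
rewrite /pattern_frequency; congr (_%:R / _).
rewrite -!sum1_card [RHS](reindex_inj (@mulIg _ (perm (@rev_ord_inj N)))) /=.
apply: eq_bigl => s; rewrite !inE; congr H.
by apply/ffunP => p; rewrite !ffunE !permM !permE /= !leEord leq_sub2lE.
Qed.

Lemma measurable_order_pattern d (T : measurableType d) (R : realType) (N : nat)
    (X : 'I_N -> T -> R) (H : pred (pattern N)) :
  (forall j, measurable_fun setT (X j)) ->
  measurable [set t | H (order_pattern (X ^~ t))].
Proof.
move=> mX.
have -> : [set t | H (order_pattern (X ^~ t))] =
  \bigcup_(M in [set M | H M]) \bigcap_(p in [set: 'I_N * 'I_N])
     [set t | (X p.1 t <= X p.2 t) = M p].
  apply/seteqP; split => [t /= Ht|t /= [M HM /= Mt]].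
    by exists (order_pattern (X ^~ t)) => // p _ /=; rewrite ffunE.
  suff -> : order_pattern (X ^~ t) = M by [].
  by apply/ffunP => p; rewrite ffunE -Mt.
apply: fin_bigcup_measurable => // M _; apply: fin_bigcap_measurable => // p _.
have := measurable_fun_ler (mX p.1) (mX p.2).
by move=> /(_ measurableT [set M p] I); rewrite setTI.
Qed.

(** * Borel sets of score vectors *)

(* Alias of ['I_N -> R] carrying the pointed structure required by
   [g_sigma_algebraType]. *)
Definition score_vector (R : realType) (N : nat) := 'I_N -> R.
HB.instance Definition _ R N := gen_eqMixin (score_vector R N).
HB.instance Definition _ R N := gen_choiceMixin (score_vector R N).
HB.instance Definition _ R N := isPointed.Build (score_vector R N) (fun=> 0).

Definition borel_vector (R : realType) (N : nat) : measurableType _ :=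
  g_sigma_algebraType (@rectangles R N : set (set (score_vector R N))).

Lemma measurable_coordinate (R : realType) (N : nat) (j : 'I_N) :
  measurable_fun setT (fun x : borel_vector R N => x j).
Proof.
move=> _ B mB; rewrite setTI; apply: sub_sigma_algebra.
exists (fun k => if k == j then B else setT); split => [k|]; first by case: ifP.
apply/seteqP; split => [x /= Bx k|x /= /(_ j)]; last by rewrite eqxx.
by case: eqP => [->|].
Qed.

Lemma measurable_rectangle d d' (T : measurableType d) (V : measurableType d')
    (N : nat) (X : 'I_N -> T -> V) (B : 'I_N -> set V) :
  (forall j, measurable_fun setT (X j)) -> (forall j, measurable (B j)) ->
  measurable [set t | forall j, B j (X j t)].
Proof.
move=> mX mB; have -> : [set t | forall j, B j (X j t)] = \bigcap_j (X j @^-1` B j).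
  by apply/seteqP; split => [t /= Bt j _|t /= Bt j]; exact: Bt.
apply: fin_bigcap_measurable => // j _.
by rewrite -[X in measurable X]setTI; exact: mX.
Qed.

Lemma measurable_vector d (T : measurableType d) (R : realType) (N : nat)
    (X : 'I_N -> T -> R) :
  (forall j, measurable_fun setT (X j)) ->
  measurable_fun setT (fun t => (X ^~ t) : borel_vector R N).
Proof.
move=> mX.
apply: (@measurability _ _ T (borel_vector R N) setT _ (@rectangles R N)) => //.
by move=> _ [_ [B [mB ->]] <-]; rewrite setTI; exact: measurable_rectangle.
Qed.

Lemma eq_law_rectangles d d' (T : measurableType d) (T' : measurableType d')
    (R : realType) (P : probability T R) (Q : probability T' R) (N : nat)
    (X : 'I_N -> T -> R) (Y : 'I_N -> T' -> R) :
  (forall j, measurable_fun setT (X j)) -> (forall j, measurable_fun setT (Y j)) ->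
  (forall B : 'I_N -> set R, (forall j, measurable (B j)) ->
     P [set t | forall j, B j (X j t)] = Q [set t | forall j, B j (Y j t)]) ->
  forall A, borel_prod A -> P [set t | A (X ^~ t)] = Q [set t | A (Y ^~ t)].
Proof.
move=> mX mY eqPQ A borelA.
pose X' : {mfun T >-> borel_vector R N} :=
  HB.pack (fun t => X ^~ t)
    (isMeasurableFun.Build _ _ _ _ _ (measurable_vector mX)).
pose Y' : {mfun T' >-> borel_vector R N} :=
  HB.pack (fun t => Y ^~ t)
    (isMeasurableFun.Build _ _ _ _ _ (measurable_vector mY)).
apply: (@measure_unique _ R (borel_vector R N) (@rectangles R N) (fun=> setT)
  erefl _ _ _ (distribution P X') (distribution Q Y')) => //.
- move=> _ _ [B [mB ->]] [C [mC ->]]; exists (fun j => B j `&` C j); split.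
    by move=> j; exact: measurableI.
  by apply/seteqP; split => x /= => [[Bx Cx] j|BCx]; split=> // j; have [] := BCx j.
- by move=> _; exists (fun=> setT); split => //; apply/seteqP; split.
- by rewrite bigcup_const.
- by move=> _ [B [mB ->]]; exact: eqPQ.
- move=> _; apply: le_lt_trans (ltry 1).
  exact: (probability_le1 (distribution P X') measurableT).
Qed.

(** * Exchangeability and order patterns *)

Lemma sum_measure_multiplicity d (T : measurableType d) (R : realType)
    (mu : {measure set T -> \bar R}) (I : finType) (E : I -> set T) (c : nat) :
  (forall i, measurable (E i)) -> {ae mu, forall t, #|[pred i | t \in E i]| = c} ->
  (\sum_i mu (E i) = c%:R%:E * mu setT)%E.
Proof.
move=> mE ae_c.
have mind i : measurable_fun setT (fun t => (\1_(E i) t)%:E : \bar R).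
  exact/measurable_EFinP/measurable_indic.
under eq_bigr do rewrite -[E _]setIT -integral_indic//.
rewrite -ge0_integral_sum// -integral_cst//.
apply: ae_eq_integral => //; first exact: emeasurable_sum.
apply: filterS ae_c => t <- _ /=.
rewrite sumEFin -sum1_card natr_sum [in RHS]big_mkcond /=; congr EFin.
by apply: eq_bigr => i _; rewrite indicE inE; case: (t \in E i).
Qed.

Lemma borel_prod_order_pattern (R : realType) (N : nat) (H : pred (pattern N)) :
  borel_prod [set x : 'I_N -> R | H (order_pattern x)].
Proof. exact: (measurable_order_pattern H (@measurable_coordinate R N)). Qed.

Lemma exchangeable_order_pattern d (T : measurableType d) (R : realType)
    (P : probability T R) (N : nat) (S : 'I_N -> T -> R) (H : pred (pattern N)) :
  (forall j, measurable_fun setT (S j)) -> exchangeable P S -> no_ties_as P S ->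
  P [set t | H (order_pattern (S ^~ t))] = (pattern_frequency R H)%:E.
Proof.
move=> mS S_exch S_noties.
set A := [set t | H (order_pattern (S ^~ t))].
pose E (s : 'S_N) := [set t | H (order_pattern (fun j => S (s j) t))].
have PE s : P (E s) = P A by exact: (S_exch s _ (borel_prod_order_pattern H)).
have sumPE : (\sum_(s : 'S_N) P (E s) =
    #|[pred s : 'S_N | H (order_pattern s)]|%:R%:E * P setT)%E.
  apply: sum_measure_multiplicity => [s|].
    by apply: measurable_order_pattern => j; exact: mS.
  apply: filterS S_noties => t S_inj.
  rewrite -(card_order_pattern_perm H S_inj); apply: eq_card => s.
  by rewrite !inE; apply/idP/idP; rewrite inE.
have PA_fin : P A \is a fin_num.
  by apply: fin_num_measure; exact: measurable_order_pattern.
move: sumPE; under eq_bigr do rewrite PE.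
rewrite probability_setT mule1 -(fineK PA_fin) sumEFin sumr_const card_Sn.
move=> -[PA_eq].
congr EFin; rewrite /pattern_frequency -PA_eq -[_ *+ N`!]mulr_natr.
by rewrite mulfK// pnatr_eq0 -lt0n fact_gt0.
Qed.

(** * Independent and identically distributed families *)

Section iid.
Context {d d'} {T : measurableType d} {V : measurableType d'} {R : realType}.
Variables (P : probability T R) (mu : probability V R).

Definition iid (k : nat) (X : 'I_k -> T -> V) : Prop :=
  forall B : 'I_k -> set V, (forall j, measurable (B j)) ->
    P [set t | forall j, B j (X j t)] = (\prod_(j < k) mu (B j))%E.

Lemma iid_perm (k : nat) (X : 'I_k -> T -> V) (s : 'S_k) :
  iid X -> iid (fun j => X (s j)).
Proof.
move=> iidX B mB; rewrite (reindex_inj (@perm_inj _ s^-1%g)) -iidX//.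
congr (P _); apply/seteqP; split => t /= Bt j.
  by have := Bt (s^-1%g j); rewrite permKV.
by have := Bt (s j); rewrite permK.
Qed.

Lemma iid_pair (k : nat) (X : 'I_k -> T -> V) (i j : 'I_k) (A B : set V) :
  iid X -> i != j -> measurable A -> measurable B ->
  P [set t | A (X i t) /\ B (X j t)] = (mu A * mu B)%E.
Proof.
move=> iidX ij mA mB.
pose C l := if l == i then A else if l == j then B else setT.
have Ci : C i = A by rewrite /C eqxx.
have Cj : C j = B by rewrite /C eq_sym (negbTE ij) eqxx.
have -> : [set t | A (X i t) /\ B (X j t)] = [set t | forall l, C l (X l t)].
  apply/seteqP; split => t /= => [[At Bt] l|Ct].
    by rewrite /C; case: eqP => [->//|_]; case: eqP => [->|].
  by split; [rewrite -Ci|rewrite -Cj]; exact: Ct.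
rewrite iidX; last by move=> l; rewrite /C; do 2![case: ifP => // _].
rewrite (bigD1 i)//= (bigD1 j) 1?eq_sym//= Ci Cj big1 ?mule1//.
by move=> l /andP[li lj]; rewrite /C (negbTE li) (negbTE lj) probability_setT.
Qed.

End iid.

Lemma measurable_set_eq d (T : measurableType d) (R : realType) (f g : T -> R) :
  measurable_fun setT f -> measurable_fun setT g -> measurable [set t | f t = g t].
Proof.
move=> mf mg; have := measurable_fun_eqr mf mg.
move=> /(_ measurableT [set true] I); rewrite setTI.
by congr (measurable _); apply/seteqP; split => t /eqP.
Qed.

Section real_iid.
Context {d} {T : measurableType d} {R : realType}.
Local Notation RR := (measurableTypeR R).
Variables (P : probability T R) (mu : probability RR R).
Variables (k : nat) (X : 'I_k -> T -> R).
Hypothesis mX : forall j, measurable_fun setT (X j).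
Hypothesis iidX : iid P mu X.

Lemma iid_exchangeable : exchangeable P X.
Proof.
by move=> s; apply: eq_law_rectangles => // B mB; rewrite iidX// (iid_perm s iidX).
Qed.

Hypothesis mu_atomless : forall x, mu [set x] = 0%E.

Lemma iid_pair_eq0 (i j : 'I_k) : i != j -> P [set t | X i t = X j t] = 0%E.
Proof.
move=> ij.
have mXij : measurable_fun setT (fun t => (X i t, X j t) : (RR * RR)%type).
  by apply: (@measurable_fun_pair _ _ _ T RR RR); exact: mX.
pose Xij : {mfun T >-> (RR * RR)%type} :=
  HB.pack (fun t => (X i t, X j t)) (isMeasurableFun.Build _ _ _ _ _ mXij).
pose D := [set p : (RR * RR)%type | p.1 = p.2].
have mD : measurable D by exact: (@measurable_set_eq _ (RR * RR)%type).
transitivity (distribution P Xij D) => //.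
rewrite -(@product_measure_unique _ _ _ _ _ mu mu)//; last first.
  by move=> A B mA mB; exact: (iid_pair iidX).
rewrite -(integral0 mu setT); apply: eq_integral => x _.
rewrite -(mu_atomless x) /=; congr (mu _).
by apply/seteqP; split => y; rewrite /xsection /= inE.
Qed.

Lemma iid_no_ties : no_ties_as P X.
Proof.
have ae_neq i j : {ae P, forall t, X i t = X j t -> i = j}.
  have [->|ij] := eqVneq i j; first exact: aeW.
  exists [set t | X i t = X j t]; split; last 1 first.
  - by move=> t /=; apply: contra_notP => Xij /Xij.
  - exact: measurable_set_eq.
  - exact: iid_pair_eq0.
apply: filterS (filter_forall _ (fun i => filter_forall _ (ae_neq i))).
by move=> t X_inj i j; exact: X_inj.
Qed.

End real_iid.

Section iid_tuple.
Context {d} {V : measurableType d} {R : realType} (mu : probability V R).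

Definition tuple_cons (k : nat) (p : V * k.-tuple V) : k.+1.-tuple V :=
  [tuple of p.1 :: p.2].

Lemma measurable_tuple_cons (k : nat) : measurable_fun setT (@tuple_cons k).
Proof. exact: measurable_cons. Qed.

HB.instance Definition _ (k : nat) :=
  isMeasurableFun.Build _ _ _ _ (@tuple_cons k) (@measurable_tuple_cons k).

Fixpoint iid_tuple (k : nat) : probability (k.-tuple V) R :=
  match k with
  | 0 => \d_[tuple]
  | k'.+1 => distribution (mu \x iid_tuple k')%E (@tuple_cons k')
  end.

Lemma iid_tuple_iid (k : nat) :
  iid (iid_tuple k) mu (fun j (t : k.-tuple V) => tnth t j).
Proof.
elim: k => [|k IH] B mB.
  by rewrite big_ord0 /= diracE mem_set// => -[].
rewrite big_ord_recl -IH// -product_measure1E//; last first.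
  exact: (measurable_rectangle (@measurable_tnth _ V k)
            (fun j => mB (lift ord0 j))).
rewrite [LHS]/=/distribution /pushforward; congr ((mu \x iid_tuple k)%E _).
apply/seteqP; split => [[x t] /= Bt|[x t] /= [Bx Bt] j].
  by split=> [|j]; [exact: (Bt ord0)|have := Bt (lift ord0 j); rewrite tnthS].
by case: (unliftP ord0 j) => [i ->|->] //; rewrite tnthS.
Qed.

End iid_tuple.

(** * Iterated integrals over the unit cube *)

Section iid_uniform.
Context {R : realType}.
Local Notation RR := (measurableTypeR R).

Definition standard_uniform : probability RR R :=
  @uniform_prob R 0 1 ltr01.

Lemma standard_uniform_set1 (x : R) : standard_uniform [set x] = 0%E.
Proof.
have /null_content_dominatesP := @dominates_uniform_prob R 0 1 ltr01; apply => //.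
exact: lebesgue_measure_set1.
Qed.

Lemma iid_unif_expectE (k : nat) (F : seq R -> R) :
  (forall s, 0 <= F s) ->
  measurable_fun setT (fun t : k.-tuple RR => F t) ->
  iid_unif_expect k F = (\int[iid_tuple standard_uniform k]_t (F t)%:E)%E.
Proof.
elim: k F => [|k IH] F F0 mF.
  by rewrite /= integral_dirac//; [rewrite diracT mul1e|exact/measurable_EFinP].
have mFcons : measurable_fun setT (fun p => (F (@tuple_cons _ RR k p))%:E).
  apply/measurable_EFinP; apply: (measurableT_comp mF).
  exact: measurable_tuple_cons.
rewrite [RHS]/= ge0_integral_distribution//; last first.
- by move=> t; rewrite lee_fin.
- exact/measurable_EFinP.
rewrite fubini_tonelli1//; last by move=> p; rewrite lee_fin.
rewrite /standard_uniform integral_uniform; last 2 first.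
- apply: measurable_fun_fubini_tonelli_F => [|p]; first exact: mFcons.
  by rewrite lee_fin; exact: F0.
- by move=> x; apply: integral_ge0 => t _; rewrite lee_fin.
rewrite subr0 invr1 mul1e; apply: eq_integral => x _.
apply: (IH (fun s => F (x :: s))) => [s|]; first exact: F0.
by apply: (measurableT_comp mF); exact: measurable_cons.
Qed.

Lemma iid_unif_expect_order_pattern (N : nat) (H : pred (pattern N)) :
  iid_unif_expect N (fun u : seq R => (H (order_pattern (fun j => nth 0 u j)))%:R) =
  (pattern_frequency R H)%:E.
Proof.
set U := fun j (t : N.-tuple RR) => tnth t j : R.
have mU j : measurable_fun setT (U j) by exact: measurable_tnth.
have iidU : iid (iid_tuple standard_uniform N) standard_uniform U.
  exact: iid_tuple_iid.
have mE : measurable [set t | H (order_pattern (U ^~ t))].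
  exact: measurable_order_pattern.
rewrite -(exchangeable_order_pattern H mU (iid_exchangeable mU iidU)
  (iid_no_ties mU iidU standard_uniform_set1)).
have indE (t : N.-tuple RR) :
    (H (order_pattern (fun j : 'I_N => nth 0 t j)))%:R =
    \1_[set t | H (order_pattern (U ^~ t))] t :> R.
  rewrite indicE; congr (nat_of_bool _)%:R.
  have -> : (fun j : 'I_N => nth 0 t j) = U ^~ t :> ('I_N -> R).
    by apply/funext => j; rewrite /U (tnth_nth 0).
  by apply/idP/idP; rewrite inE.
rewrite iid_unif_expectE//; last first.
  by under eq_fun do rewrite indE; exact: measurable_indic.
by under eq_integral do rewrite indE; rewrite integral_indic// setIT.
Qed.

Lemma iid_unif_expect_cat (n m : nat) (F G : seq R -> R) :
  (forall u, size u = n -> {subset u <= `[0, 1]} ->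
     iid_unif_expect m (fun v => F (u ++ v)) = (G u)%:E) ->
  iid_unif_expect (n + m) F = iid_unif_expect n G.
Proof.
elim: n F G => [|n IH] F G FG; first exact: (FG [::]).
apply: eq_integral => x; rewrite inE /= => x01.
apply: IH => u size_u u01; apply: (FG (x :: u)) => [|y].
  by rewrite /= size_u.
by rewrite inE => /predU1P[->|/u01].
Qed.

Lemma iid_unif_expect_prod (m : nat) (f : 'I_m -> R -> R) :
  (forall i, measurable_fun (`[0, 1]%classic : set R) (f i)) ->
  (forall i x, 0 <= f i x) ->
  iid_unif_expect m (fun v => \prod_(i < m) f i (nth 0 v i)) =
  (\prod_(i < m) \int[lebesgue_measure]_(x in `[0%R, 1%R]) (f i x)%:E)%E.
Proof.
suff scaled c : 0 <= c ->
    (forall i, measurable_fun (`[0, 1]%classic : set R) (f i)) ->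
    (forall i x, 0 <= f i x) ->
    iid_unif_expect m (fun v => c * \prod_(i < m) f i (nth 0 v i)) =
    (c%:E * \prod_(i < m) \int[lebesgue_measure]_(x in `[0%R, 1%R]) (f i x)%:E)%E.
  move=> mf f0; rewrite -[RHS]mul1e -scaled//.
  by under [in RHS]eq_fun do rewrite mul1r.
elim: m f c => [|m IH] f c c0 mf f0; first by rewrite /= !big_ord0 mulr1 mule1.
have mf0 : measurable_fun (`[0, 1]%classic : set RR) (fun x => (f ord0 x)%:E).
  by apply/measurable_EFinP; exact: mf.
rewrite big_ord_recl muleA -ge0_integralZl//; last by move=> x _; rewrite lee_fin.
rewrite -ge0_integralZr//; last 3 first.
- exact: measurable_funeM.
- by move=> x _; rewrite -EFinM lee_fin mulr_ge0.
- by apply: prode_ge0 => i _; apply: integral_ge0 => x _; rewrite lee_fin.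
rewrite /=; apply: eq_integral => x _.
under [F in iid_unif_expect _ F]eq_fun do rewrite big_ord_recl /= mulrA.
by rewrite -EFinM -IH// mulr_ge0.
Qed.

End iid_uniform.

(** * Spacings of order statistics *)

Lemma nth_le_count {disp} {T : orderType disp} (x0 v : T) (s : seq T) (i : nat) :
  sorted <=%O s -> (i < size s)%N ->
  (nth x0 s i <= v)%O = (i < count (<= v)%O s)%N.
Proof.
move=> s_sorted i_lt; have [/nth_count_le->//|v_lt] := ltnP i (count (<= v)%O s).
by apply/negbTE; rewrite -ltNge nth_count_gt// v_lt.
Qed.

Definition rank_in (R : realType) (u : seq R) (v : R) : nat := count (<= v) u.

Section spacings.
Context {R : realType} (u : seq R).
Hypothesis u01 : {subset u <= `[0, 1]}.

Lemma sorted_ostat : sorted <=%R (0 :: rcons (sort <=%R u) 1).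
Proof.
have s01 x : x \in sort <=%R u -> 0 <= x <= 1.
  by rewrite mem_sort => /u01; rewrite in_itv.
rewrite /= rcons_path (path_sortedE le_trans) sort_le_sorted andbT.
apply/andP; split; first by apply/allP => x /s01/andP[].
by have := mem_last 0 (sort <=%R u); rewrite inE => /predU1P[->//|/s01/andP[]].
Qed.

Lemma ostat_le (k : nat) : (k <= size u)%N -> ostat u k <= ostat u k.+1.
Proof.
move=> ku; rewrite /ostat (sorted_leq_nth le_trans lexx 0 sorted_ostat)//.
  by rewrite inE /= size_rcons size_sort ltnS ltnW.
by rewrite inE /= size_rcons size_sort !ltnS.
Qed.

Lemma ostat_itv01 (k : nat) : ostat u k \in `[0, 1].
Proof.
rewrite /ostat; set w := 0 :: rcons _ _.
have [k_lt|k_ge] := ltnP k (size w); last first.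
  by rewrite nth_default// in_itv /= lexx ler01.
have := mem_nth 0 k_lt; rewrite inE mem_rcons inE mem_sort.
by move=> /or3P[/eqP->|/eqP->|/u01//]; rewrite in_itv /= lexx ler01.
Qed.

Lemma rank_in_spacing (l : nat) (v : R) : (l <= size u)%N -> v \in `[0, 1[ ->
  (rank_in u v == l) = (v \in `[ostat u l, ostat u l.+1[).
Proof.
move=> lu; rewrite !in_itv /= => /andP[v0 v1].
have ostat_count k : (k < (size u).+2)%N -> (ostat u k <= v) = (k <= rank_in u v)%N.
  move=> ku; rewrite /ostat (nth_le_count _ _ sorted_ostat) /=;
    last by rewrite size_rcons size_sort.
  by rewrite v0 -cats1 count_cat count_sort /= leNgt v1 !addn0 ltnS.
rewrite ltNge !ostat_count ?ltnS ?(leqW lu)//.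
by rewrite -ltnNge ltnS eqn_leq andbC.
Qed.

Let rank_indicE (l : nat) : (l <= size u)%N ->
  {in `[0%R, 1%R[, (fun v => (rank_in u v == l)%:R : R) =1
                   \1_`[ostat u l, ostat u l.+1[}.
Proof.
by move=> lu v v01; rewrite rank_in_spacing// indicE mem_setE.
Qed.

Lemma measurable_rank_in (l : nat) : (l <= size u)%N ->
  measurable_fun (`[0, 1]%classic : set R) (fun v => (rank_in u v == l)%:R : R).
Proof.
move=> lu; apply/measurable_fun_itv_bndo_bndcP.
apply: (eq_measurable_fun (\1_`[ostat u l, ostat u l.+1[ : R -> R)).
  by move=> v; rewrite inE => /= v01; rewrite rank_indicE.
exact/measurable_funTS/measurable_indic.
Qed.

Lemma integral_rank_in (l : nat) : (l <= size u)%N ->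
  (\int[lebesgue_measure]_(v in `[0%R, 1%R]) (rank_in u v == l)%:R%:E =
   (ostat u l.+1 - ostat u l)%:E)%E.
Proof.
move=> lu; rewrite -integral_itv_bndo_bndc; last first.
  apply/measurable_EFinP/measurable_fun_itv_bndo_bndcP.
  exact: measurable_rank_in.
under eq_integral => v v01 do rewrite (rank_indicE lu (set_mem v01)).
rewrite integral_indic// setIidl; last first.
  move=> v /=; rewrite !in_itv /= => /andP[lv vl].
  have := ostat_itv01 l; have := ostat_itv01 l.+1; rewrite !in_itv /=.
  by move=> /andP[_ l1] /andP[l0 _]; rewrite (le_trans l0 lv) (lt_le_trans vl l1).
rewrite [LHS]lebesgue_measure_itv /= lte_fin; case: ltP => // le_ostat.
have -> : ostat u l.+1 = ostat u l by apply/le_anti; rewrite le_ostat ostat_le.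
by rewrite subrr.
Qed.

End spacings.

(** * Conformal p-values *)

Definition descending_ranks (n m : nat) (l : 'I_m -> 'I_n.+1) :
    pred (pattern (n + m)) :=
  fun M => [forall i : 'I_m,
              #|[pred j : 'I_n | M (rshift n i, lshift m j)]| == l i].

Lemma conformal_pvalueP (R : realType) (n m : nat) (x : 'I_(n + m) -> R)
    (l : 'I_m -> 'I_n.+1) :
  (forall i, conformal_pvalue x i = (l i).+1%:R / n.+1%:R) <->
  descending_ranks l (order_pattern x).
Proof.
have pvalueE i : (conformal_pvalue x i == (l i).+1%:R / n.+1%:R) =
    (#|[pred j : 'I_n | order_pattern x (rshift n i, lshift m j)]| == l i).
  rewrite /conformal_pvalue (inj_eq (mulIf _)) ?invr_eq0 ?pnatr_eq0//.
  rewrite eqr_nat add1n eqSS; congr (_ == _); apply: eq_card => j.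
  by rewrite !inE ffunE /=; apply/idP/idP; rewrite inE.
split=> [px|/forallP px i]; last by apply/eqP; rewrite pvalueE.
by apply/forallP => i; rewrite -pvalueE px.
Qed.

Lemma prod_natr_bool (R : pzSemiRingType) (I : finType) (b : pred I) :
  \prod_i (b i)%:R = [forall i, b i]%:R :> R.
Proof.
rewrite -natr_prod -(big_andE xpredT b); congr _%:R; apply/esym.
by apply: (big_morph nat_of_bool) => // c d; rewrite mulnb.
Qed.

Lemma Pnm_pmf_order_pattern (R : realType) (n m : nat) (l : 'I_m -> 'I_n.+1) :
  Pnm_pmf R l = iid_unif_expect (n + m) (fun u : seq R =>
    ((descending_ranks l \o converse) (order_pattern (fun j => nth 0 u j)))%:R).
Proof.
symmetry; apply: iid_unif_expect_cat => u size_u u01.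
have lu i : (l i <= size u)%N by rewrite size_u -ltnS.
transitivity (iid_unif_expect m (fun v : seq R =>
    \prod_(i < m) (rank_in u (nth 0 v i) == l i)%:R)); last first.
  rewrite (iid_unif_expect_prod (f := fun i x => (rank_in u x == l i)%:R))//;
    last by move=> i; exact: measurable_rank_in.
  by rewrite -prodEFin; apply: eq_bigr => i _; exact: integral_rank_in.
congr iid_unif_expect; apply/funext => v.
rewrite prod_natr_bool; congr (nat_of_bool _)%:R.
apply: eq_forallb => i; congr (_ == _).
rewrite /rank_in -sum1_card -sum1_count (big_nth 0) size_u big_mkord.
apply: eq_bigl => j; rewrite !inE !ffunE /=.
by rewrite !nth_cat size_u ltn_ord ltnNge leq_addr /= addKn.
Qed.

Theorem proposition2 (d : measure_display) (T : measurableType d)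
  (R : realType) (P : probability T R) (n m : nat) (hn : (0 < n)%N) (hm : (0 < m)%N)
  (S : 'I_(n + m) -> T -> R)
  (S_meas : forall j, measurable_fun setT (S j))
  (S_exch : exchangeable P S) (S_noties : no_ties_as P S) :
  forall l : 'I_m -> 'I_n.+1,
    P [set t | forall i : 'I_m,
         conformal_pvalue (fun j => S j t) i = (l i).+1%:R / (n.+1)%:R]
    = Pnm_pmf R l.
Proof.
move=> l.
have -> : [set t | forall i, conformal_pvalue (S ^~ t) i = (l i).+1%:R / n.+1%:R] =
          [set t | descending_ranks l (order_pattern (S ^~ t))].
  by apply/seteqP; split => t /= /conformal_pvalueP.
rewrite exchangeable_order_pattern// Pnm_pmf_order_pattern.
by rewrite iid_unif_expect_order_pattern pattern_frequency_converse.
Qed.
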